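(* Let $Q$ be a loop that is both an AIM loop and an LC loop. Then $N(Q)$ is a normal subloop of $Q$, the factor loop $Q/N(Q)$ is an abelian group, and $Q/Z(Q)$ is a group. In particular, $Q$ is centrally nilpotent of class at most $3$.
   Context: A loop $(Q,\cdot)$ is a set with a binary operation and an element $1$ with $1x=x1=x$ such that every left translation $L_x: y\mapsto xy$ and right translation $R_x: y\mapsto yx$ is a bijection of $Q$; left and right division are $x\backslash y = yL_x^{-1}$ and $x/y = xR_y^{-1}$. A subloop is a nonempty subset closed under $\cdot,\backslash,/$. The multiplication group is $\mathrm{Mlt}(Q)=\langle L_x,R_x : x\in Q\rangle$ and the inner mapping group is $\mathrm{Inn}(Q)=\{\varphi\in\mathrm{Mlt}(Q): 1\varphi=1\}$. $Q$ is an AIM loop if $\mathrm{Inn}(Q)$ is abelian. A subloop $S$ is normal if $S\varphi=S$ for all $\varphi\in\mathrm{Inn}(Q)$; for normal $S$, $Q/S$ is the loop of cosets $xS$ with $xS\cdot yS=(xy)S$. $Q$ is an LC loop if $x(x(yz))=(x(xy))z$ for all $x,y,z\in Q$. The nucleus is $N(Q)=N_\lambda\cap N_\rho\cap N_\mu$ where $N_\lambda=\{a: ax\cdot y=a\cdot xy\ \forall x,y\}$, $N_\rho=\{a: xy\cdot a=x\cdot ya\ \forall x,y\}$, $N_\mu=\{a: xa\cdot y=x\cdot ay\ \forall x,y\}$. The commutant is $C(Q)=\{a: ax=xa\ \forall x\}$ and the center is $Z(Q)=C(Q)\cap N(Q)$ (always a normal subloop). Define $Z_0(Q)=\{1\}$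 and $Z_{i+1}(Q)$ as the preimage of $Z(Q/Z_i(Q))$ under the canonical projection $Q\to Q/Z_i(Q)$; $Q$ is (centrally) nilpotent of class $n$ if $Z_{n-1}(Q)\ne Q$ and $Z_n(Q)=Q$. *)

(* Defs.v *)
Set Implicit Arguments.

(* A loop: binary operation with identity such that all left and right
   translations are bijections.  We record the inverse maps explicitly as the
   divisions  x\y = y L_x^{-1}  and  x/y = x R_y^{-1}. *)
Record loop := Loop {
  car :> Type;
  mul : car -> car -> car;
  ldiv : car -> car -> car;
  rdiv : car -> car -> car;
  one : car;
  mul1l : forall x, mul one x = x;
  mul1r : forall x, mul x one = x;
  mulKl : forall x y, ldiv x (mul x y) = y;
  mulKl' : forall x y, mul x (ldiv x y) = y;
  mulKr : forall x y, rdiv (mul x y) y = x;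
  mulKr' : forall x y, mul (rdiv x y) y = x
}.

Section LoopDefs.
Variable Q : loop.
Local Notation "x * y" := (@mul Q x y).

Inductive mlt : (Q -> Q) -> Prop :=
  | mlt_id : mlt (fun y => y)
  | mlt_L : forall (x : Q) f, mlt f -> mlt (fun y => x * f y)
  | mlt_Linv : forall (x : Q) f, mlt f -> mlt (fun y => @ldiv Q x (f y))
  | mlt_R : forall (x : Q) f, mlt f -> mlt (fun y => f y * x)
  | mlt_Rinv : forall (x : Q) f, mlt f -> mlt (fun y => @rdiv Q (f y) x).

Definition inn (f : Q -> Q) : Prop := mlt f /\ f (@one Q) = @one Q.

Definition AIM : Prop :=
  forall f g, inn f -> inn g -> forall y, f (g y) = g (f y).

Definition LC : Prop :=
  forall x y z, x * (x * (y * z)) = (x * (x * y)) * z.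

Definition subloop (S : Q -> Prop) : Prop :=
  (exists s, S s) /\
  (forall x y, S x -> S y -> S (x * y)) /\
  (forall x y, S x -> S y -> S (@ldiv Q x y)) /\
  (forall x y, S x -> S y -> S (@rdiv Q x y)).

Definition normal (S : Q -> Prop) : Prop :=
  subloop S /\
  forall f, inn f ->
    (forall x, S x -> S (f x)) /\ (forall y, S y -> exists x, S x /\ f x = y).

Definition N_lambda (a : Q) : Prop := forall x y, (a * x) * y = a * (x * y).
Definition N_rho (a : Q) : Prop := forall x y, (x * y) * a = x * (y * a).
Definition N_mu (a : Q) : Prop := forall x y, (x * a) * y = x * (a * y).
Definition nucleus (a : Q) : Prop := N_lambda a /\ N_rho a /\ N_mu a.
Definition commutant (a : Q) : Prop := forall x, a * x = x * a.
Definition center (a : Q) : Prop := commutant a /\ nucleus a.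

Definition coset (S : Q -> Prop) (x : Q) : Q -> Prop :=
  fun u => exists s, S s /\ u = x * s.

Definition coset_eq (S : Q -> Prop) (x y : Q) : Prop :=
  forall u, coset S x u <-> coset S y u.

(* The factor loop Q/S (multiplication xS.yS = (xy)S) is a group,
   i.e. its multiplication is associative. *)
Definition quotient_group (S : Q -> Prop) : Prop :=
  forall x y z, coset_eq S ((x * y) * z) (x * (y * z)).

Definition quotient_abelian_group (S : Q -> Prop) : Prop :=
  quotient_group S /\ forall x y, coset_eq S (x * y) (y * x).

(* a is in the preimage of Z(Q/S): aS lies in the commutant and the nucleus
   of the factor loop Q/S. *)
Definition center_quot (S : Q -> Prop) (a : Q) : Prop :=
  (forall x, coset_eq S (a * x) (x * a)) /\
  (forall x y, coset_eq S ((a * x) * y) (a * (x * y))) /\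
  (forall x y, coset_eq S ((x * y) * a) (x * (y * a))) /\
  (forall x y, coset_eq S ((x * a) * y) (x * (a * y))).

Fixpoint Zs (i : nat) : Q -> Prop :=
  match i with
  | O => fun x => x = @one Q
  | S i' => center_quot (Zs i')
  end.

Definition nilpotent_class (n : nat) : Prop :=
  (forall x, Zs n x) /\
  match n with O => True | S m => ~ (forall x, Zs m x) end.

End LoopDefs.

(* Main.v *)
(* Let I = Inn(Q) and, for an inner map f, let f.[q] = L_q f L_q^-1. As I is abelian, f.[q] equals
   m f m^-1 for every m in Mlt(Q) with m(1) = q. Let A be the left nucleus. By LC, x x lies in A and Q
   has the left inverse property, so A is also the middle nucleus, that is, the set of common fixed
   points of the inner maps c_{x,y} = L_x^-1 R_y^-1 L_x R_y.

   As L_x^2 commutes with R_y, c_{x,y} is inverted by L_x, so c_{x,y}.[m(x)] is the inverse of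
   c_{x,y}.[m(1)] for all m in Mlt(Q). From this Q/A is seen to be commutative.
   The commutator of c_{x,w}.[z] and c_{u,v} squares to 1 and turns out to be symmetric in all
   five variables, while a cyclic identity makes it the product of two of its permutations; hence it
   is trivial, and Q/A is an abelian group. The remaining claims follow from the commuting of
   the c_{x,y} and of the maps in Inn_l(Q) with the conjugations T_t. *)

From Stdlib Require Import ssreflect Setoid Morphisms.
From Stdlib Require Import FunctionalExtensionality ProofIrrelevance Classical.
Require Import Defs.
Set Implicit Arguments.

Local Arguments mul1l {l}. Local Arguments mul1r {l}. Local Arguments mulKl {l}.
Local Arguments mulKl' {l}. Local Arguments mulKr {l}. Local Arguments mulKr' {l}.

Section MultiplicationGroup.
Variable Q : loop.
Local Notation "x · y" := (@mul Q x y) (at level 40, left associativity).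
Local Notation "x \ y" := (@ldiv Q x y) (at level 40, left associativity).
Local Notation "x / y" := (@rdiv Q x y).
Local Notation e := (@one Q).

(** * Mlt(Q) as a group of permutations *)

Lemma mlt_comp f g : mlt Q f -> mlt Q g -> mlt Q (fun q => f (g q)).
Proof. by move=> Hf Hg; elim: Hf => [|x f' _ H|x f' _ H|x f' _ H|x f' _ H] //; constructor. Qed.

(** Elements of Mlt(Q) bundled with their inverses. Maps act from the left: [f * g] applies g
    first. *)
Record perm := Perm {
  pfun :> Q -> Q;
  pinv : Q -> Q;
  pfun_mlt : mlt Q pfun;
  pinv_mlt : mlt Q pinv;
  pfunK : forall q, pinv (pfun q) = q;
  pinvK : forall q, pfun (pinv q) = q
}.

Lemma permP (f g : perm) : (forall q, f q = g q) -> f = g.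
Proof.
case: f g => f f' Hf Hf' fK f'K [g g' Hg Hg' gK g'K] /= fg.
have Ef : f = g by apply: functional_extensionality.
subst g.
have Ef' : f' = g' by apply: functional_extensionality => q; rewrite -{1}(g'K q) fK.
subst g'.
by f_equal; apply: proof_irrelevance.
Qed.

Definition pmul (f g : perm) : perm.
Proof.
refine (@Perm (fun q => f (g q)) (fun q => pinv g (pinv f q)) _ _ _ _).
- by apply: mlt_comp; apply: pfun_mlt.
- by apply: (@mlt_comp (pinv g) (pinv f)); apply: pinv_mlt.
- by move=> q /=; rewrite !pfunK.
- by move=> q /=; rewrite !pinvK.
Defined.

Definition pone : perm :=
  @Perm (fun q => q) (fun q => q) (mlt_id Q) (mlt_id Q) (fun _ => eq_refl) (fun _ => eq_refl).

Definition pV (f : perm) : perm :=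
  @Perm (pinv f) f (pinv_mlt f) (pfun_mlt f) (pinvK f) (pfunK f).

Definition L (x : Q) : perm :=
  @Perm (fun q => x · q) (fun q => x \ q) (mlt_L x (mlt_id Q)) (mlt_Linv x (mlt_id Q))
    (mulKl x) (mulKl' x).

Definition R (x : Q) : perm :=
  @Perm (fun q => q · x) (fun q => q / x) (mlt_R x (mlt_id Q)) (mlt_Rinv x (mlt_id Q))
    (fun q => mulKr q x) (fun q => mulKr' q x).

Declare Scope perm_scope.
Bind Scope perm_scope with perm.
Delimit Scope perm_scope with P.
Local Notation "1" := pone : perm_scope.
Local Notation "f * g" := (pmul f g) : perm_scope.
Local Notation "f ^-1" := (pV f) (at level 3, left associativity, format "f ^-1") : perm_scope.
Local Open Scope perm_scope.

Lemma pA (f g h : perm) : f * (g * h) = f * g * h. Proof. exact: permP. Qed.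
Lemma p1m (f : perm) : 1 * f = f. Proof. exact: permP. Qed.
Lemma pm1 (f : perm) : f * 1 = f. Proof. exact: permP. Qed.
Lemma pmV (f : perm) : f * f^-1 = 1. Proof. by apply: permP => q /=; rewrite pinvK. Qed.
Lemma pVm (f : perm) : f^-1 * f = 1. Proof. by apply: permP => q /=; rewrite pfunK. Qed.
Lemma pmK (f g : perm) : f * g * g^-1 = f. Proof. by rewrite -pA pmV pm1. Qed.
Lemma pmVK (f g : perm) : f * g^-1 * g = f. Proof. by rewrite -pA pVm pm1. Qed.
Lemma pVV (f : perm) : f^-1^-1 = f. Proof. exact: permP. Qed.
Lemma pVM (f g : perm) : (f * g)^-1 = g^-1 * f^-1. Proof. exact: permP. Qed.

Definition conj (m f : perm) := m * f * m^-1.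
Definition comm (f g : perm) := f * g * f^-1 * g^-1.
Definition commute (f g : perm) := f * g = g * f.

Ltac grp := rewrite /conj /comm; apply: permP => ? /=;
  rewrite ?(pfunK, pinvK, mulKl, mulKl', mulKr, mulKr'); try reflexivity.

Lemma pmI (f g h : perm) : f * g = f * h -> g = h.
Proof. by move=> H; rewrite -(p1m g) -(p1m h) -(pVm f) -!pA H. Qed.
Lemma pIm (f g h : perm) : g * f = h * f -> g = h.
Proof. by move=> H; rewrite -(pmK g f) H pmK. Qed.
Lemma pVI (f g : perm) : f^-1 = g^-1 -> f = g.
Proof. by move=> H; rewrite -(pVV f) H pVV. Qed.

Lemma conjM m f g : conj m (f * g) = conj m f * conj m g. Proof. by grp. Qed.
Lemma conjV m f : conj m f^-1 = (conj m f)^-1. Proof. by grp. Qed.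
Lemma conj_comp m n f : conj (m * n) f = conj m (conj n f). Proof. by grp. Qed.
Lemma conj1m f : conj 1 f = f. Proof. by grp. Qed.
Lemma conjm1 m : conj m 1 = 1. Proof. by grp. Qed.
Lemma conj_comm m f g : conj m (comm f g) = comm (conj m f) (conj m g). Proof. by grp. Qed.

Lemma commute_conj f g : commute f g <-> conj f g = g.
Proof.
rewrite /commute /conj; split=> [->|H]; first by grp.
by rewrite -{2}H; grp.
Qed.
Lemma commute_sym f g : commute f g -> commute g f. Proof. by rewrite /commute => ->. Qed.
Lemma commuteM f g h : commute f g -> commute f h -> commute f (g * h).
Proof. by rewrite /commute => Hg Hh; rewrite pA Hg -pA Hh pA. Qed.
Lemma commuteV f g : commute f g -> commute f g^-1.
Proof. by rewrite !commute_conj conjV => ->. Qed.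
Lemma commuteJ m f g : commute f g -> commute (conj m f) (conj m g).
Proof. by rewrite /commute -!conjM => ->. Qed.
Lemma commute_comm f g : commute f g <-> comm f g = 1.
Proof.
rewrite commute_conj /comm -/(conj f g); split=> [->|H]; first by grp.
by rewrite -(pmVK (conj f g) g) H p1m.
Qed.

(** * Inner maps and their conjugates *)

Definition stab (f : perm) := f e = e.

Lemma stabM f g : stab f -> stab g -> stab (f * g). Proof. by rewrite /stab /= => Hf ->. Qed.
Lemma stabV f : stab f -> stab f^-1. Proof. by rewrite /stab /= => {1}<-; rewrite pfunK. Qed.

Hypothesis aim : AIM Q.

Lemma stab_commute f g : stab f -> stab g -> commute f g.
Proof. by move=> Hf Hg; apply: permP; apply: (aim (f := f) (g := g)); split=> //; exact: pfun_mlt. Qed.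

(* Inn(Q) being abelian, transporting an inner map to the stabilizer of q does not depend on the
   transporting element; see conj_at. *)
Definition at_ (f : perm) (q : Q) := conj (L q) f.
Local Notation "f .[ q ]" := (at_ f q) (at level 2, left associativity, format "f .[ q ]").

(** m is [L (m e)] times an inner map, and that inner map commutes with f. *)
Lemma conj_stab m f : stab f -> conj m f = f.[m e].
Proof.
move=> Hf; have Hi : stab ((L (m e))^-1 * m) by rewrite /stab /= -{2}(mul1r (m e)) mulKl.
have -> : m = L (m e) * ((L (m e))^-1 * m) by grp.
rewrite conj_comp /= -/(L _); have -> : (m e · (m e \ m e)) = m e by rewrite mulKl'.
by rewrite /at_; f_equal; apply/commute_conj/stab_commute.
Qed.

Lemma conj_at m f q : stab f -> conj m f.[q] = f.[m q].
Proof. by move=> Hf; rewrite /at_ -conj_comp conj_stab //= mul1r. Qed.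

Lemma L_one : L e = 1. Proof. by apply: permP => q; exact: mul1l. Qed.
Lemma at1 f : f.[e] = f. Proof. by rewrite /at_ L_one conj1m. Qed.
Lemma atM f g q : (f * g).[q] = f.[q] * g.[q]. Proof. exact: conjM. Qed.
Lemma atV f q : f^-1.[q] = f.[q]^-1. Proof. exact: conjV. Qed.
Lemma at_commute f g q : stab f -> stab g -> commute f.[q] g.[q].
Proof. by move=> Hf Hg; apply/commuteJ/stab_commute. Qed.
Lemma commute_at m f q : stab f -> (commute m f.[q] <-> f.[m q] = f.[q]).
Proof. by move=> Hf; rewrite commute_conj conj_at. Qed.

Lemma at_fix f q : stab f -> f.[q] q = q.
Proof.
move=> Hf; rewrite /at_ /conj /=.
have -> : q \ q = e by rewrite -{2}(mul1r q) mulKl.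
by rewrite Hf mul1r.
Qed.

(** * The left nucleus *)

Hypothesis lc : LC Q.

Lemma L_sq x : L x * L x = L (x · x).
Proof. by apply: permP => q /=; move: (lc x e q); rewrite mul1l mul1r. Qed.

(** The left inverse property: [lc] with y = x \ e reads x(x((x \ e)q)) = xq, and x cancels. *)
Lemma L_inv x : (L x)^-1 = L (x \ e).
Proof.
apply: permP => q /=; move: (lc x (x \ e) q); rewrite mulKl' mul1r => H.
by rewrite -{1}(mulKl x ((x \ e) · q)) -[LHS]/(x \ _); f_equal; rewrite -{1}(mulKl x q) -H mulKl.
Qed.

Lemma mulVl x q : (x \ e) · q = x \ q.
Proof. by rewrite -[RHS]/((L x)^-1 q) L_inv. Qed.

Definition inA a := forall y, commute (L a) (R y).

Lemma inAP a : inA a <-> N_lambda Q a.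
Proof.
split=> H x.
- by move=> y; move: (f_equal (fun f : perm => f x) (H y)) => /= ->.
- by apply: permP => y /=; rewrite H.
Qed.

Lemma L_Al a x : inA a -> L (a · x) = L a * L x.
Proof. by move=> /inAP H; apply: permP => q /=; rewrite H. Qed.

Lemma L_prod x y z : L x * L y = L z -> L (x · y) = L x * L y.
Proof. by move=> H; rewrite H; f_equal; move: (f_equal (fun f : perm => f e) H) => /=; rewrite !mul1r. Qed.

Lemma invK x : (x \ e) \ e = x.
Proof. by rewrite -{2}(mul1r x) -[RHS]/(L x e) -(pVV (L x)) L_inv. Qed.

Lemma inA_V a : inA a -> inA (a \ e).
Proof. by move=> H y; rewrite -L_inv; apply: commute_sym; apply: commuteV; apply: commute_sym. Qed.

Lemma inA_M a b : inA a -> inA b -> inA (a · b).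
Proof. by move=> Ha Hb y; rewrite L_Al //; apply: commute_sym; apply: commuteM; apply: commute_sym. Qed.

(** The inverse of L_x L_a is a product of left translations whose first factor comes from A, hence
    a left translation; by [L_inv] so is L_x L_a, and its value at e identifies it. *)
Lemma L_Ar a x : inA a -> L (x · a) = L x * L a.
Proof.
move=> Ha; apply: (@L_prod _ _ ((a \ e) · (x \ e) \ e)).
by rewrite -L_inv L_Al; [exact: inA_V | rewrite -!L_inv; grp].
Qed.

Lemma inA_of_Lr a : (forall x, L (x · a) = L x * L a) -> inA a.
Proof.
move=> H; rewrite -(invK a); apply: inA_V; apply/inAP => x y.
have E : L (a \ e) * L x = L ((x \ e) · a \ e) by rewrite -!L_inv H -L_inv; grp.
by rewrite -[LHS]/(L ((a \ e) · x) y) (L_prod E).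
Qed.

Lemma inA_sq x : inA (x · x).
Proof. by move=> y; rewrite -L_sq; apply: permP => q /=; rewrite lc; move: (lc x q e); rewrite !mul1r. Qed.

(** Middle associator map: (x · c x y a) · y = x · (a · y). *)
Definition c x y := (L x)^-1 * (R y)^-1 * L x * R y.

Lemma stab_c x y : stab (c x y).
Proof. by rewrite /stab /= mul1l mulKr -{2}(mul1r x) mulKl. Qed.

Lemma c_fix x y a : c x y a = a <-> (x · a) · y = x · (a · y).
Proof.
rewrite /=; split=> [H|<-]; last by rewrite mulKr mulKl.
by rewrite -{1}H mulKl' mulKr'.
Qed.

Lemma inA_c a : inA a <-> forall x y, c x y a = a.
Proof.
split=> [Ha x y|H].
- by apply/c_fix; rewrite -[LHS]/(L (x · a) y) L_Ar.
- by apply: inA_of_Lr => x; apply: permP => y; move/c_fix: (H x y).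
Qed.

Lemma inA_stab f a : stab f -> inA a -> inA (f a).
Proof.
move=> Hf /inA_c Ha; apply/inA_c => x y.
by rewrite -{2}(Ha x y) -[LHS]/((c x y * f) a) (stab_commute (stab_c x y) Hf).
Qed.

Lemma stab_div x : stab ((R x)^-1 * L x).
Proof. by rewrite /stab /= mul1r -{1}(mul1l x) mulKr. Qed.

(** Right translations commute with L_a. Past L_x the factor a becomes (x · a) / x, an inner image
    of a and so again in A; left division by x is left translation by x \ e. *)
Lemma mlt_A f : mlt Q f -> forall a, inA a -> exists2 b, inA b & forall t, f (a · t) = b · f t.
Proof.
elim=> [|x f' _ IH|x f' _ IH|x f' _ IH|x f' _ IH] a Ha; first by exists a.
all: have [b Hb Eb] := IH a Ha.
- exists ((R x)^-1 (L x b)); first exact: (inA_stab (stab_div x) Hb).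
  move=> t; rewrite Eb -[LHS]/((L x * L b) (f' t)) -L_Ar //=.
  have := inA_stab (stab_div x) Hb => /inAP /= <-.
  by rewrite mulKr'.
- exists ((R (x \ e))^-1 (L (x \ e) b)); first exact: (inA_stab (stab_div _) Hb).
  move=> t; rewrite Eb -(mulVl x (b · f' t)) -(mulVl x (f' t)) -[LHS]/((L (x \ e) * L b) (f' t)) -L_Ar //=.
  have := inA_stab (stab_div (x \ e)) Hb => /inAP /= <-.
  by rewrite mulKr'.
- by exists b => // t; rewrite Eb; move/inAP: Hb => ->.
- exists b => // t; rewrite Eb -{1}(mulKr' (f' t) x).
  by move/inAP: Hb => <-; rewrite mulKr.
Qed.

Lemma conj_L_A (m : perm) a : inA a -> exists2 b, inA b & conj m (L a) = L b.
Proof.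
move=> Ha; have [b Hb E] := mlt_A (pfun_mlt m) Ha; exists b => //.
by apply: permP => q; rewrite /conj /= E pinvK.
Qed.

Lemma conj_L_stab f a : stab f -> inA a -> conj f (L a) = L (f a).
Proof.
move=> Hf Ha; have [b Hb E] := conj_L_A f Ha.
rewrite E; f_equal; move: (f_equal (fun g : perm => g e) E).
by rewrite /conj /= mul1r -[pinv f e]/(f^-1 e) (stabV Hf) mul1r.
Qed.

Definition fixA (f : perm) := stab f /\ forall a, inA a -> f a = a.

Lemma fixA_c x y : fixA (c x y).
Proof. by split=> [|a /inA_c]; [exact: stab_c|]. Qed.

(** As f fixes a, it commutes with L_a, so f.[a] = f; now conjugate by m. *)
Lemma at_A f (m : perm) a : fixA f -> inA a -> f.[m a] = f.[m e].
Proof.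
move=> [Hs Hf] Ha; rewrite -(conj_at m a Hs) -(conj_stab m Hs); f_equal.
by apply/commute_conj; apply: commute_sym; apply/commute_conj; rewrite conj_L_stab // Hf.
Qed.

Lemma c_inv x y : conj (L x) (c x y) = (c x y)^-1.
Proof.
apply: permP => q; rewrite /conj /= mulKl'; f_equal.
rewrite -[LHS](mulKl x); f_equal.
have := inA_sq x => /(_ y) H; rewrite -L_sq in H.
by move: (f_equal (fun f : perm => f (x \ q)) H) => /= ->; rewrite mulKl'.
Qed.

(* Reading m(x) as a term in which x occurs: any occurrence can be deleted at the price of a sign. *)
Lemma c_del x y (m : perm) : (c x y).[m x] = (c x y).[m e]^-1.
Proof.
by rewrite -(conj_at m x (stab_c x y)) -(conj_stab m (stab_c x y)) -conjV -c_inv.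
Qed.

Lemma mulVr w : (w \ e) · w = e. Proof. by rewrite mulVl -{2}(mul1r w) mulKl. Qed.

(** * Left inner maps *)

Definition h x w := (L (w · x))^-1 * L w * L x.

Lemma stab_h x w : stab (h x w).
Proof. by rewrite /stab /= mul1r -{2}(mul1r (w · x)) mulKl. Qed.

(** Moving R_t past the three left translations in [h x w] leaves one [c] for each. The one for w ·
    x comes out conjugated by h, which has no effect since inner maps commute. *)
Lemma h_R x w t :
  (h x w)^-1 * (R t)^-1 * h x w * R t = (c (w · x) t)^-1 * (c w t).[x \ e] * c x t.
Proof.
have E : (h x w)^-1 * (c (w · x) t)^-1 * h x w = (c (w · x) t)^-1.
  have /commute_conj := stab_commute (stabV (stab_h x w)) (stabV (stab_c (w · x) t)).
  by rewrite /conj pVV.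
have -> : (c w t).[x \ e] = conj (L x)^-1 (c w t) by rewrite conj_stab //; exact: stab_c.
by rewrite -E /h /c; grp.
Qed.

(** By [c_del], (c x y).[m x] is the inverse of c x y, and by [at_fix] it fixes m x. So c x y fixes
    m x, for every y. *)
Lemma L_mul_del x (m : perm) : m e = e -> L (x · m x) = L x * L (m x).
Proof.
move=> He; apply: permP => y.
suff /c_fix : c x y (m x) = m x by [].
have := c_del x y m; rewrite He at1 => E.
have := at_fix (m x) (stab_c x y); rewrite E => {1}<-.
by rewrite -[LHS]/((c x y * (c x y)^-1) (m x)) pmV.
Qed.

(** Squares lie in A, so L_w L_x L_x L_w is left translation by an element b' of A. *)
Lemma h_swap x w : exists v, conj ((L x * L w)^-1) (h x w) = (L v * h w x)^-1.
Proof.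
have [b Hb Eb] := conj_L_A (L w) (inA_sq x).
set b' := b · (w · w); have Hb' : inA b' by apply: inA_M => //; exact: inA_sq.
have E : L w * L x * L x * L w = L b'.
  rewrite /b' L_Al // -L_sq -Eb -L_sq; grp.
have Ew : L (w · x · (x · w)) = L (w · x) * L (x · w).
  (* This map fixes e and sends w · x to x · w. *)
  have := @L_mul_del (w · x) (R w * (L w)^-1) => /=.
  rewrite mulKl => -> //; exact: mulVr.
exists ((b' \ e) · (w · x · (x · w))).
rewrite L_Al; first exact: inA_V.
by rewrite -L_inv Ew -E /h; grp.
Qed.

(* Such an f also commutes with all conjugates of h x w by h_R, then with those of h w x by h_swap,
   hence with (c x t).[w \ e] by h_R again; conjugated by L w, this says that every c x t commutes
   with f.[w] and so fixes its value at e. *)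
Lemma inA_stab_w f w : stab f -> (forall t q, commute f (c w t).[q]) -> inA (w · f (w \ e)).
Proof.
move=> Hf Hc.
have Hh x q : commute f (h x w).[q].
  set t := q \ e.
  have Et : (R t)^-1 e = q by rewrite /= -(mulKl' q e) mulKr.
  rewrite -Et -(conj_stab _ (stab_h x w)) /conj pVV.
  have -> : (R t)^-1 * h x w * R t = h x w * ((h x w)^-1 * (R t)^-1 * h x w * R t) by grp.
  rewrite h_R; apply: commuteM; first exact: (stab_commute Hf (stab_h _ _)).
  apply: commuteM; last exact: (stab_commute Hf (stab_c _ _)).
  by apply: commuteM => //; exact: (stab_commute Hf (stabV (stab_c _ _))).
have Hca x t : commute f (c x t).[w \ e].
  have [v Ev] := h_swap x w.
  have Hq q : commute f (conj q (L v * h w x)).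
    rewrite -(pVV (L v * h w x)) -Ev conjV -conj_comp conj_stab; first exact: stab_h.
    exact: commuteV.
  have Hv : commute f (L v).
    rewrite -(pmK (L v) (h w x)); apply: commuteM; first by rewrite -(conj1m (L v * _)).
    exact: (stab_commute Hf (stabV (stab_h _ _))).
  have Hhr : commute f (conj (R t)^-1 (h w x)).
    have -> : conj (R t)^-1 (h w x) = (conj (R t)^-1 (L v))^-1 * conj (R t)^-1 (L v * h w x).
      by rewrite conjM; grp.
    apply: commuteM => //; apply: commuteV.
    have -> : conj (R t)^-1 (L v) = L v * c v t by rewrite /c; grp.
    by apply: commuteM => //; exact: (stab_commute Hf (stab_c _ _)).
  have -> : (c x t).[w \ e]
      = c (x · w) t * ((h w x)^-1 * conj (R t)^-1 (h w x)) * (c w t)^-1.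
    have := h_R w x t.
    have -> : (h w x)^-1 * (R t)^-1 * h w x * R t = (h w x)^-1 * conj (R t)^-1 (h w x) by grp.
    by move=> ->; grp.
  apply: commuteM; last exact: (stab_commute Hf (stabV (stab_c _ _))).
  apply: commuteM; first exact: (stab_commute Hf (stab_c _ _)).
  by apply: commuteM => //; exact: (stab_commute Hf (stabV (stab_h _ _))).
apply/inA_c => x t.
have := commuteJ (L w) (Hca x t); rewrite conj_at; first exact: stab_c.
rewrite [L w _]mulKl' at1 => H.
have -> : w · f (w \ e) = conj (L w) f e by [].
rewrite -[LHS]/((c x t * conj (L w) f) e) -H.
by rewrite -[LHS]/(conj (L w) f (c x t e)) stab_c.
Qed.

(** Let p = x · w and r = h w x q. Then p · r = (p / w) · (w · q), and deleting p on both sides by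
    [c_del] leaves r and q with the same sign. So h w x commutes with all conjugates of c p t, as
    [inA_stab_w] requires. *)
Lemma h_mul x w : inA (x · (w · (x · w \ e))).
Proof.
have -> : x · (w · (x · w \ e)) = (x · w) · h w x (x · w \ e) by rewrite /= mulKl'.
apply: inA_stab_w; first exact: stab_h.
move=> t q; apply/commute_at; first exact: stab_c.
set p := x · w; set r := h w x q.
have Er : p · r = x · (w · q) by rewrite /r /= mulKl'.
have E1 : (c p t).[p · r] = (c p t).[r]^-1 by rewrite -{2}(mul1l r); exact: (c_del p t (R r)).
have := c_del p t (R (w · q) * (R w)^-1).
rewrite /= mulKr -Er E1 => /pVI ->.
have -> : e / w = w \ e by rewrite -{1}(mulVr w) mulKr.
by rewrite mulVl mulKl.
Qed.

(** * The factor loop modulo the left nucleus *)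

Definition eqA r q := exists2 a, inA a & r = a · q.

Lemma inA1 : inA e. Proof. by rewrite -(mul1l e); apply: inA_sq. Qed.
Lemma eqA_refl q : eqA q q. Proof. by exists e; [exact: inA1 | rewrite mul1l]. Qed.
Lemma eqA_sym r q : eqA r q -> eqA q r.
Proof. by move=> [a Ha ->]; exists (a \ e); [exact: inA_V | rewrite mulVl mulKl]. Qed.
Lemma eqA_trans r q s : eqA r q -> eqA q s -> eqA r s.
Proof.
move=> [a Ha ->] [b Hb ->]; exists (a · b); first exact: inA_M.
by move/inAP: Ha => ->.
Qed.
Lemma eqA_perm (m : perm) r q : eqA r q -> eqA (m r) (m q).
Proof. by move=> [a Ha ->]; have [b Hb E] := mlt_A (pfun_mlt m) Ha; exists b. Qed.
Lemma eqA1 a : eqA a e <-> inA a.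
Proof. by split=> [[b Hb ->]|H]; [rewrite mul1r | exists a; rewrite ?mul1r]. Qed.
Lemma eqA_LL x q : eqA (x · (x · q)) q.
Proof. by exists (x · x); [exact: inA_sq | rewrite -[LHS]/((L x * L x) q) L_sq]. Qed.
Lemma eqA_LV x q : eqA (x \ q) (x · q).
Proof. by have := eqA_sym (eqA_LL x (x \ q)); rewrite mulKl'. Qed.

(** Modulo A left division is multiplication, so [h_mul] says that x(w(xw)) is trivial; solve for
    xw. *)
Lemma eqA_mulC x w : eqA (x · w) (w · x).
Proof.
have H1 : eqA (x · (w · (x · w))) e.
  apply: eqA_trans (proj2 (eqA1 _) (h_mul x w)).
  apply: (eqA_perm (L x)); apply: (eqA_perm (L w)); apply: eqA_sym.
  by have := eqA_LV (x · w) e; rewrite mul1r.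
have := eqA_perm ((L w)^-1 * (L x)^-1) H1; rewrite /= !mulKl => H2.
apply: eqA_trans H2 _; apply: eqA_trans (eqA_LV _ _) _.
by apply: (eqA_perm (L w)); have := eqA_LV x e; rewrite mul1r.
Qed.

Lemma eqA_RV x q : eqA (q / x) (x · q).
Proof.
have H : eqA ((x · q) · x) q by apply: eqA_trans (eqA_mulC _ _) _; exact: eqA_LL.
by have := eqA_sym (eqA_perm (R x)^-1 H); rewrite /= mulKr.
Qed.

Lemma eqA_mull x y q : eqA x y -> eqA (x · q) (y · q).
Proof. exact: (eqA_perm (R q)). Qed.

Lemma at_eqA f q r : fixA f -> eqA q r -> f.[q] = f.[r].
Proof. by move=> Hf [a Ha ->]; rewrite -{2}(mul1l r); exact: (at_A (R r) Hf Ha). Qed.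

Definition trivA (f : perm) := stab f /\ forall q, eqA (f q) q.

Lemma trivA_commute f g q : trivA f -> fixA g -> commute f g.[q].
Proof. by move=> [_ Hf] Hg; apply/commute_at; [case: Hg | apply: at_eqA]. Qed.

Lemma commute_at_l f g q : stab g -> commute f g.[q \ e] -> commute f.[q] g.
Proof. by move=> Hg /(commuteJ (L q)); rewrite conj_at //= mulKl' at1. Qed.

Lemma trivA_at_commute f g q : trivA f -> fixA g -> commute f.[q] g.
Proof. by move=> Hf Hg; apply: commute_at_l; [case: Hg | exact: trivA_commute]. Qed.

Lemma c_word x w q : eqA (c x w q) (x · (w · (x · (w · q)))).
Proof.
apply: eqA_trans (eqA_perm ((L x)^-1 * (R w)^-1 * L x) (eqA_mulC q w)) _.
by apply: eqA_trans (eqA_perm (L x)^-1 (eqA_RV w _)) _; exact: eqA_LV.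
Qed.

(** On Q/A left translations are involutions and c x w acts as L_x L_w L_x L_w. *)
Lemma c_swap x w : trivA (c x w * c w x).
Proof.
split=> [|q]; first exact: stabM (stab_c _ _) (stab_c _ _).
apply: eqA_trans (c_word x w (c w x q)) _.
apply: eqA_trans (eqA_perm (L x * L w * L x * L w) (c_word w x q)) _.
apply: eqA_trans (eqA_perm (L x * L w * L x) (eqA_LL w _)) _.
apply: eqA_trans (eqA_perm (L x * L w) (eqA_LL x _)) _.
by apply: eqA_trans (eqA_perm (L x) (eqA_LL w _)) _; exact: eqA_LL.
Qed.

(** * The normal closure in Mlt(Q) of the maps [c x y] with x fixed *)

Inductive Gam x : perm -> Prop :=
  | Gam_c y q : Gam x (c x y).[q]
  | Gam_M f g : Gam x f -> Gam x g -> Gam x (f * g)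
  | Gam_V f : Gam x f -> Gam x f^-1.

Lemma Gam_c1 x y : Gam x (c x y). Proof. by rewrite -(at1 (c x y)); constructor. Qed.

Lemma Gam_conj x m f : Gam x f -> Gam x (conj m f).
Proof.
elim=> [y q|f' g _ IHf _ IHg|f' _ IH].
- by rewrite conj_at; [exact: stab_c | constructor].
- by rewrite conjM; constructor.
- by rewrite conjV; constructor.
Qed.

(** x · c x y q equals (x · (q · y)) / y; deleting x on both sides by [c_del] leaves c x y q and q
    with the same sign. *)
Lemma c_commute x y z q : commute (c x y) (c x z).[q].
Proof.
apply/commute_at; first exact: stab_c.
apply: pVI; have := c_del x z (R (c x y q)); rewrite /= mul1l mulKl' => <-.
by have := c_del x z ((R y)^-1 * R (q · y)); rewrite /= mul1l mulKr.
Qed.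

Lemma commute_Gam x f : (forall y q, commute f (c x y).[q]) -> forall g, Gam x g -> commute f g.
Proof. by move=> H g; elim=> [y q|? ? _ Hf _ Hg|? _ Hf]; [|apply: commuteM|apply: commuteV]. Qed.

Lemma Gam_commute x f g : Gam x f -> Gam x g -> commute f g.
Proof.
move=> Hf; apply: commute_Gam => z r; apply: commute_sym; move: f Hf.
apply: commute_Gam => y q; apply: commute_sym.
have := commuteJ (L q) (c_commute x y z (q \ r)).
by rewrite conj_at ?[L q _]mulKl' //; exact: stab_c.
Qed.

Lemma Gam_R x f : Gam x f -> conj (R x) f = f^-1.
Proof.
elim=> [y q|f' g Hf IHf Hg IHg|f' _ IH].
- by rewrite conj_at; [exact: stab_c | have := c_del x y (L q); rewrite /= mul1r].
- by rewrite conjM IHf IHg (Gam_commute Hf Hg) pVM.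
- by rewrite conjV IH.
Qed.

Lemma Gam_comml x f g : Gam x f -> Gam x (comm f g).
Proof.
move=> Hf; have -> : comm f g = f * conj g f^-1 by grp.
by constructor=> //; apply: Gam_conj; constructor.
Qed.

Lemma Gam_commr x f g : Gam x g -> Gam x (comm f g).
Proof.
move=> Hg; have -> : comm f g = conj f g * g^-1 by grp.
by constructor; [apply: Gam_conj | constructor].
Qed.

Lemma comm_M f g k : comm (f * g) k = conj f (comm g k) * comm f k. Proof. by grp. Qed.

Lemma commMl x f g k : Gam x f -> Gam x g -> comm (f * g) k = comm f k * comm g k.
Proof.
move=> Hf Hg; rewrite comm_M; have Hk := Gam_comml k Hg.
have /commute_conj -> := Gam_commute Hf Hk.
exact: Gam_commute Hk (Gam_comml k Hf).
Qed.

Lemma commVl x f k : Gam x f -> comm f^-1 k = (comm f k)^-1.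
Proof.
move=> Hf; apply: (@pIm (comm f k)); rewrite pVm -(commMl k (Gam_V Hf) Hf) pVm.
by grp.
Qed.

Lemma commVr x f k : Gam x k -> comm f k^-1 = (comm f k)^-1.
Proof.
move=> Hk; have -> : comm f k^-1 = (comm k^-1 f)^-1 by grp.
by rewrite (commVl _ Hk); grp.
Qed.

Lemma comm_cancel_l f g k : commute f k -> commute f g -> comm (f * g) k = comm g k.
Proof.
move=> Hk Hg; rewrite comm_M; have /commute_comm -> := Hk; rewrite pm1.
have /commute_conj -> // : commute f (comm g k).
by rewrite /comm; do !apply: commuteM => //; exact: commuteV.
Qed.

Lemma comm_cancel_r f g k : commute g k -> comm (f * g) k = comm f k.
Proof. by move=> /commute_comm Hk; rewrite comm_M Hk conjm1 p1m. Qed.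

(** * The commutators [F] and their symmetries *)

Definition F z x w u v := comm (c x w).[z] (c u v).

Lemma commute_L_A f a : fixA f -> inA a -> commute (L a) f.
Proof.
move=> [Hs Hf] Ha; apply: commute_sym; apply/commute_conj.
by rewrite conj_L_stab // Hf.
Qed.

(** Up to an inner map f is L_k, so F is the commutator of L_k and g. As L_k centralizes Gam x, the
    square of F is the commutator of L_k L_k and g, trivial because k · k lies in A. *)
Lemma F_sq z x w u v : F z x w u v * F z x w u v = 1.
Proof.
rewrite /F; set f := (c x w).[z]; set k := f e; set g := c u v.
have Hj : stab ((L k)^-1 * f) by rewrite /stab -[LHS]/(k \ k) -{2}(mul1r k) mulKl.
have -> : comm f g = comm (L k) g.
  have -> : f = L k * ((L k)^-1 * f) by grp.
  by rewrite comm_cancel_r //; exact: (stab_commute Hj (stab_c _ _)).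
have HG : Gam x (comm (L k) g).
  have -> : comm (L k) g = comm f g; last by apply: Gam_comml; constructor.
  have -> : f = L k * ((L k)^-1 * f) by grp.
  by rewrite comm_cancel_r //; exact: (stab_commute Hj (stab_c _ _)).
have Hk : commute (L k) (comm (L k) g).
  move: HG; apply: commute_Gam => y q; apply/commute_at; first exact: stab_c.
  (* Here k = z · c x w (z \ e); [c_commute] drops the map c x w, leaving (z · (z \ e)) · q = q. *)
  rewrite -[L k q]/((R q * L z) (c x w (z \ e))) -(conj_at (R q * L z) _ (stab_c x y)).
  have /(commute_at _ _ (stab_c x y)) -> := c_commute x w y (z \ e).
  by rewrite (conj_at _ _ (stab_c x y)) /= mulKl' mul1l.
have : comm (L k * L k) g = 1.
  apply/commute_comm; rewrite L_sq; apply: commute_L_A; [exact: fixA_c | exact: inA_sq].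
by rewrite comm_M; move/commute_conj: Hk => ->.
Qed.

Lemma F_V z x w u v : (F z x w u v)^-1 = F z x w u v.
Proof. by apply: (@pIm (F z x w u v)); rewrite pVm F_sq. Qed.

Lemma F_eqA z z' x w u v : eqA z z' -> F z x w u v = F z' x w u v.
Proof. by move=> H; rewrite /F (at_eqA (fixA_c x w) H). Qed.

Lemma F1 x w u v : F e x w u v = 1.
Proof. by apply/commute_comm; rewrite at1; exact: (stab_commute (stab_c _ _) (stab_c _ _)). Qed.

(** By [c_swap], c x w is the inverse of c w x up to a map trivial on Q/A; the inverse is absorbed
    since F is an involution. *)
Lemma F_swap z x w u v : F z x w u v = F z w x u v.
Proof.
have -> : F z x w u v = comm ((c x w * c w x).[z] * (c w x)^-1.[z]) (c u v) by rewrite -atM pmK.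
rewrite comm_cancel_l.
- by apply: trivA_at_commute; [exact: c_swap | exact: fixA_c].
- by apply: at_commute; [exact: stabM (stab_c _ _) (stab_c _ _) | exact: stabV (stab_c _ _)].
- by rewrite atV (commVl _ (Gam_c w x z)) -/(F _ _ _ _ _) F_V.
Qed.

Lemma F_swapr z x w u v : F z x w u v = F z x w v u.
Proof.
have -> : F z x w u v = comm (c x w).[z] (c u v * c v u * (c v u)^-1) by rewrite pmK.
set f := c u v * c v u; have Hf : stab f by exact: stabM (stab_c _ _) (stab_c _ _).
have -> : comm (c x w).[z] (f * (c v u)^-1) = (comm (f * (c v u)^-1) (c x w).[z])^-1 by grp.
rewrite comm_cancel_l.
- by apply: trivA_commute; [exact: c_swap | exact: fixA_c].
- exact: (stab_commute Hf (stabV (stab_c _ _))).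
- have -> : (comm (c v u)^-1 (c x w).[z])^-1 = comm (c x w).[z] (c v u)^-1 by grp.
  by rewrite (commVr _ (Gam_c1 v u)) -/(F _ _ _ _ _) F_V.
Qed.

Lemma F_roles z x w u v : F z x w u v = conj (L z) (F z u v x w).
Proof.
have -> : F z u v x w = F (z \ e) u v x w.
  by apply: F_eqA; apply: eqA_sym; have := eqA_LV z e; rewrite mul1r.
rewrite -[F (z \ e) _ _ _ _]F_V conjV /F conj_comm conj_at ?[L z _]mulKl' ?at1; first exact: stab_c.
by rewrite -/(at_ _ z); grp.
Qed.

Lemma F_del z x w u v (m : perm) : z = m x -> F z x w u v = F (m e) x w u v.
Proof.
by move=> ->; rewrite /F c_del (commVl _ (Gam_c x w _)) -/(F _ _ _ _ _) F_V.
Qed.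

Lemma F_del2 z x w u v (m : perm) : z = m w -> F z x w u v = F (m e) x w u v.
Proof. by move=> ->; rewrite !(F_swap _ x); apply: F_del. Qed.

(** R_u inverts by conjugation both c u v and F, which lies in Gam u. *)
Lemma F_mul3 z x w u v : F (z · u) x w u v = F z x w u v.
Proof.
rewrite {1}/F -[z · u]/(R u z) -(conj_at (R u) z (stab_c x w)).
have -> : c u v = conj (R u) (c u v)^-1 by rewrite conjV Gam_R ?pVV //; exact: Gam_c1.
rewrite -conj_comm (commVr _ (Gam_c1 u v)) -/(F _ _ _ _ _) F_V Gam_R ?F_V //.
by apply: Gam_commr; exact: Gam_c1.
Qed.

Lemma F_mul4 z x w u v : F (z · v) x w u v = F z x w u v.
Proof. by rewrite !(F_swapr _ _ _ u); exact: F_mul3. Qed.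

Lemma c_eqA x x' w : eqA x x' -> c x w = c x' w.
Proof.
move=> [a Ha ->]; rewrite /c L_Al //.
have -> : (L a * L x')^-1 * (R w)^-1 * (L a * L x') * R w
    = (L x')^-1 * (L a)^-1 * ((R w)^-1 * L a) * L x' * R w by grp.
by rewrite -(commuteV (Ha w)); grp.
Qed.

Lemma F_eqA4 z x w u v v' : eqA v v' -> F z x w u v = F z x w u v'.
Proof. by move=> H; rewrite !(F_swapr _ _ _ u) /F (c_eqA _ H). Qed.

(** * Right inner maps and the cyclic identity *)

Definition s w z := (R (w · z))^-1 * R z * R w.

Lemma stab_s w z : stab (s w z).
Proof. by rewrite /stab /= mul1l -{1}(mul1l (w · z)) mulKr. Qed.

Lemma fixA_s w z : fixA (s w z).
Proof. by split=> [|a /inAP Ha]; [exact: stab_s | rewrite /= Ha mulKr]. Qed.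

Lemma s_word w z q : eqA (s w z q) (w · z · (z · (w · q))).
Proof.
apply: eqA_trans (eqA_RV _ _) _; apply: (eqA_perm (L (w · z))).
by apply: eqA_trans (eqA_mulC _ _) _; apply: (eqA_perm (L z)); exact: eqA_mulC.
Qed.

(** The analogue of [h_R]: L_x is moved past the right translations in [s w z], and the result is
    conjugated by L_{z0}. *)
Lemma s_R x w z z0 : (c x w).[z0] * (c x z).[z0 · (e / w)] =
  (s w z).[z0 · (x \ e)]^-1 * (s w z).[z0] * (c x (w · z)).[z0].
Proof.
have E : c x w * (c x z).[e / w] = (s w z).[x \ e]^-1 * s w z * c x (w · z).
  have -> : (c x z).[e / w] = conj (R w)^-1 (c x z) by rewrite conj_stab //; exact: stab_c.
  have -> : (s w z).[x \ e] = conj (L x)^-1 (s w z) by rewrite conj_stab //; exact: stab_s.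
  by rewrite -pA (stab_commute (stab_s w z) (stab_c _ _)) /s /c; grp.
have := f_equal (conj (L z0)) E; rewrite (conjM _ (c x w)).
rewrite (conjM _ _ (c x (w · z))) (conjM _ _ (s w z)) conjV (conj_at _ _ (stab_c x z)).
by rewrite (conj_at _ _ (stab_s w z)).
Qed.

Definition P x w z z0 := (s w z).[z0 · (x \ e)]^-1 * (s w z).[z0].

(** The other three factors in [s_R] lie in Gam x. *)
Lemma Gam_P x w z z0 : Gam x (P x w z z0).
Proof.
rewrite -(pmK (P x w z z0) (c x (w · z)).[z0]) -s_R.
by apply: Gam_M; [apply: Gam_M; exact: Gam_c | apply: Gam_V; exact: Gam_c].
Qed.

Lemma F_s z0 x w z u v : F z0 x w u v * F (z0 · (e / w)) x z u v =
  comm (P x w z z0) (c u v) * F z0 x (w · z) u v.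
Proof.
rewrite /F -(commMl _ (Gam_c x w z0) (Gam_c x z _)) s_R.
by rewrite (commMl _ (Gam_P x w z z0) (Gam_c x (w · z) z0)).
Qed.

Lemma eqA_rV w : eqA (e / w) w.
Proof. by have := eqA_RV w e; rewrite mul1r. Qed.

(* F_s at w z: there the second and the last factor are trivial. *)
Lemma F_U x w z u v : F z x w u v = comm (s w z).[w · z · x]^-1 (c u v).
Proof.
have := F_s (w · z) x w z u v.
rewrite (@F_del2 (w · z) x w u v (R z)) // [R z e]mul1l.
rewrite (@F_del2 (w · z · (e / w)) x z u v (R (e / w) * L w)) // [(_ * L w) e]/= mul1r.
have -> : F (w · (e / w)) x z u v = 1.
  rewrite -(F1 x z u v); apply: F_eqA; apply/eqA1.
  apply/eqA1; apply: eqA_trans (eqA_perm (L w) (eqA_rV w)) _; apply/eqA1; exact: inA_sq.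
rewrite (@F_del2 (w · z) x (w · z) u v 1) // F1 !pm1 => ->.
(* Modulo A, [s w z] fixes w · z and its inverse, so the right factor of [P] commutes with c u v. *)
rewrite /P comm_cancel_r.
  apply: commute_at_l; first exact: stab_c.
  apply/commute_at; first exact: stab_c.
  apply: at_eqA; first exact: fixA_c.
  set p := w · z.
  apply: eqA_trans (eqA_perm (s w z) _) _; first by have := eqA_LV p e; rewrite mul1r; exact: id.
  apply: eqA_trans (s_word w z p) _.
  apply: eqA_trans (eqA_perm (L p * L z) (eqA_LL w z)) _.
  apply: eqA_trans (eqA_perm (L p) (proj2 (eqA1 _) (inA_sq z))) _.
  by rewrite [L p e]mul1r; apply: eqA_sym; have := eqA_LV p e; rewrite mul1r.
do 2!f_equal; apply: at_eqA; first exact: fixA_s.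
by apply: (eqA_perm (L (w · z))); have := eqA_LV x e; rewrite mul1r.
Qed.

Lemma s_swap w z : trivA ((s w z * c w z)^-1 * s z w).
Proof.
split=> [|q].
  by apply: stabM; [apply: stabV; apply: stabM; [exact: stab_s | exact: stab_c] | exact: stab_s].
have H : eqA (s z w q) ((s w z * c w z) q).
  apply: eqA_trans (s_word z w q) _; apply: eqA_sym.
  apply: eqA_trans (eqA_perm (s w z) (c_word w z q)) _; apply: eqA_trans (s_word _ _ _) _.
  apply: eqA_trans (eqA_perm (L (w · z) * L z) (eqA_LL w _)) _.
  apply: eqA_trans (eqA_perm (L (w · z)) (eqA_LL z _)) _.
  exact: (eqA_mull _ (eqA_mulC w z)).
apply: eqA_trans (eqA_perm (s w z * c w z)^-1 H) _.
by rewrite [X in eqA X _](pfunK (s w z * c w z) q); exact: eqA_refl.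
Qed.

(** [F_U] turns F w x z and F z x w into commutators of s z w and s w z at q. By [s_swap] these maps
    differ by c w z up to a map trivial on Q/A; c w z at q contributes F x w z after deleting z and
    w from q. *)
Lemma F_cyc w x z u v : F w x z u v = F z x w u v * F x w z u v.
Proof.
rewrite (F_U x z w) (F_U x w z).
set q := w · z · x; set g := c u v.
have -> : (s z w).[z · w · x] = (s z w).[q].
  by apply: at_eqA; [exact: fixA_s | apply: eqA_mull; exact: eqA_mulC].
set f := (s w z * c w z)^-1 * s z w.
have Ef : s z w = s w z * c w z * f by rewrite /f; grp.
have Hf : trivA f by exact: s_swap.
have -> : (s z w).[q]^-1 = f^-1.[q] * ((c w z).[q]^-1 * (s w z).[q]^-1).
  by rewrite Ef (atM _ f) (atM (s w z)) (pVM _ f.[q]) (pVM (s w z).[q]) atV.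
have [Hs Hf'] := Hf.
rewrite comm_cancel_l.
- apply: trivA_at_commute; last exact: fixA_c.
  split=> [|r]; first exact: stabV.
  by have := eqA_sym (Hf' (f^-1 r)); rewrite [X in eqA _ X](pinvK f r).
- rewrite -!atV -atM; apply: at_commute; first exact: stabV.
  by apply: stabM; apply: stabV; [exact: stab_c | exact: stab_s].
- rewrite (comm_M (c w z).[q]^-1).
  have G : Gam w (comm (s w z).[q]^-1 g).
    by rewrite -(F_U x w z) F_swap; apply: Gam_comml; exact: Gam_c.
  have /commute_conj -> : commute (c w z).[q]^-1 (comm (s w z).[q]^-1 g).
    by apply: Gam_commute G; apply: Gam_V; exact: Gam_c.
  f_equal; rewrite (commVl _ (Gam_c w z q)) -/(F _ _ _ _ _) F_V.
  rewrite (@F_del2 q w z u v (R x * L w)) // [(_ * L w) e]/= mul1r.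
  by rewrite (@F_del (w · x) w z u v (R x)) // [R x e]mul1l.
Qed.

Lemma s_commute w z u q : commute (c u (w · z)) (s w z).[q].
Proof.
set g := c u (w · z).
have H : comm (s w z).[q]^-1 g = 1.
  (* With x = (w · z) \ q the commutator is F z x w u (w · z); z may be replaced by w · z, which
     [F_mul4] deletes. *)
  rewrite -(mulKl' (w · z) q) -F_U.
  have -> : F z (w · z \ q) w u (w · z) = F (w · z) (w · z \ q) w u (w · z).
    by rewrite [RHS](@F_del2 _ _ w _ _ (R z)) // [R z e]mul1l.
  by rewrite -{1}(mul1l (w · z)) F_mul4 F1.
by rewrite -(pVV (s w z).[q]); apply: commuteV; apply: commute_sym; apply/commute_comm.
Qed.

(** In [F_s] with v = w · z, the [P] term vanishes by [s_commute], the last factor because Gam (w ·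
    z) is abelian, and the shift by e / w can be deleted. *)
Lemma F_triple z0 x w z u : F z0 x w u (w · z) = F z0 x z u (w · z).
Proof.
have := F_s z0 x w z u (w · z).
have /commute_comm -> : commute (P x w z z0) (c u (w · z)).
  apply: commute_sym; apply: commuteM; first by apply: commuteV; exact: s_commute.
  exact: s_commute.
have -> : F z0 x (w · z) u (w · z) = 1.
  rewrite F_swap F_swapr; apply/commute_comm.
  by apply: (@Gam_commute (w · z)); [exact: Gam_c | exact: Gam_c1].
have -> : F (z0 · (e / w)) x z u (w · z) = F z0 x z u (w · z).
  rewrite (F_eqA _ _ _ _ (eqA_perm (L z0) (eqA_rV w))) -[RHS]F_mul4.
  by rewrite [RHS](@F_del2 _ x z _ _ (L z0 * L w)) // [(_ * L w) e]/= mul1r.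
rewrite pm1 => H; apply: (@pIm (F z0 x z u (w · z))); by rewrite H F_sq.
Qed.

Lemma F_triple' z0 x w z u : F z0 x (w · z) u w = F z0 x (w · z) u z.
Proof. by rewrite !(F_roles _ x) F_triple. Qed.

(** Modulo A each of w, z, w · z is the product of the other two, so [F_triple] applies in several
    arrangements. *)
Lemma F_mid z0 x w u z : F z0 x w u z = F z0 x z u w.
Proof.
have Ez : eqA (w · (w · z)) z by exact: eqA_LL.
have Ew : eqA (z · (w · z)) w.
  by apply: eqA_trans (eqA_perm (L z) (eqA_mulC w z)) _; exact: eqA_LL.
have := F_triple z0 x w (w · z) u; rewrite !(F_eqA4 _ _ _ _ Ez) => ->.
by rewrite -F_triple' -(F_eqA4 _ _ _ _ Ew) -F_triple (F_eqA4 _ _ _ _ Ew).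
Qed.

Lemma F_13 z x w u v : F z x w u v = F z u w x v.
Proof. by rewrite F_swap F_swapr F_mid F_swapr F_swap. Qed.

(** Exchanging x and u in [F_cyc] preserves the other two terms by [F_13]. *)
Lemma F_exch x w z u v : F x w z u v = F u w z x v.
Proof.
have E1 : F w u z x v = F w x z u v by exact: F_13.
have E2 : F z u w x v = F z x w u v by exact: F_13.
have := F_cyc w u z x v; rewrite E1 E2 F_cyc; exact: pmI.
Qed.

(* All permutations of a value agree, so F_cyc makes it its own square. *)
Lemma F_trivial z x w u v : F z x w u v = 1.
Proof.
have EW : F w x z u v = F x w z u v.
  by rewrite [RHS]F_13 [RHS]F_exch [RHS]F_13.
have EZ : F z x w u v = F x w z u v.
  by rewrite [RHS]F_swap [RHS]F_13 [RHS]F_exch [RHS]F_13.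
have := F_cyc w x z u v; rewrite EW EZ => H.
by apply: (@pmI (F x w z u v)); rewrite -H pm1.
Qed.

(** * Associativity of Q/A *)

Lemma eqA_mulr q r : eqA r q -> exists2 a, inA a & r = q · a.
Proof.
move=> H; exists (q \ r); last by rewrite mulKl'.
have := eqA_perm (L q)^-1 H; have -> : (L q)^-1 q = e by rewrite /= -{2}(mul1r q) mulKl.
by move/eqA1.
Qed.

(** z \ c x y z is the value at e of (c x y).[z \ e], which commutes with every c u v as F is
    trivial; so each c u v fixes it. *)
Lemma c_trivial x y z : exists2 a, inA a & c x y z = z · a.
Proof.
exists (z \ c x y z); last by rewrite mulKl'.
apply/inA_c => u v.
have H : commute (c u v) (c x y).[z \ e].
  by apply: commute_sym; apply/commute_comm; exact: F_trivial.
have -> : z \ c x y z = (c x y).[z \ e] e.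
  by rewrite /at_ /conj /= mulVl invK.
rewrite -[LHS]/((c u v * (c x y).[z \ e]) e) H.
by rewrite -[LHS]/((c x y).[z \ e] (c u v e)) stab_c.
Qed.

(** z · a is a times a conjugate of z. f is multiplicative on products with left factor in A and
    commutes with conjugation by a. *)
Lemma stab_mulA f z a : stab f -> inA a -> f (z · a) = f a · (a \ (f z · a)).
Proof.
move=> Hf Ha; have Ht : stab ((L a)^-1 * R a) by rewrite /stab /= mul1l -{2}(mul1r a) mulKl.
rewrite -[RHS]/(L (f a) (((L a)^-1 * R a * f) z)) -(stab_commute Hf Ht) -(conj_L_stab Hf Ha).
by rewrite /conj /= pfunK mulKl'.
Qed.

Lemma stab_fixA f z a : stab f -> inA a -> f (z · a) = f z · a -> f a = a.
Proof.
move=> Hf Ha; rewrite stab_mulA // => H; set t := a \ (f z · a) in H.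
have : f a · t = a · t by rewrite H /t mulKl'.
by move=> E; rewrite -(mulKr (f a) t) E mulKr.
Qed.

Lemma mulA_mu x a y : inA a -> (x · a) · y = x · (a · y).
Proof. by move=> Ha; rewrite -[LHS]/(L (x · a) y) L_Ar. Qed.

Lemma c_mulA x y z a : inA a -> c x y (z · a) = c x y z · a.
Proof.
move=> Ha; rewrite stab_mulA //; first exact: stab_c.
by have /inA_c -> := Ha; rewrite mulKl'.
Qed.

Definition T t := (L t)^-1 * R t.

Lemma stab_T t : stab (T t).
Proof. by rewrite /stab /= mul1l -{2}(mul1r t) mulKl. Qed.

Lemma mul_T t z : t · T t z = z · t.
Proof. exact: mulKl'. Qed.

Lemma eqA_T t z : eqA (T t z) z.
Proof.
apply: eqA_trans (eqA_LV t _) _; apply: eqA_trans (eqA_perm (L t) (eqA_mulC z t)) _.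
exact: eqA_LL.
Qed.

Lemma centerP a : center Q a <-> inA a /\ commutant Q a.
Proof.
split=> [[Hc [Hl _]]|[Ha Hc]]; first by split=> //; apply/inAP.
have Hl : N_lambda Q a by apply/inAP.
split=> //; split=> //; split=> x y; last exact: mulA_mu.
by rewrite -!Hc -Hl Hc mulA_mu // -Hc.
Qed.

(** * Associators, commutators and nilpotency *)

Lemma c_center x y z : exists2 a, center Q a & c x y z = z · a.
Proof.
have [a Ha Ea] := c_trivial x y z; exists a => //.
have Hcom b : inA b -> a · b = b · a.
  move=> Hb.
  have Hb' : inA ((R z)^-1 (L z b)) by exact: (inA_stab (stab_div z) Hb).
  (* Write z · b as b' · z with b' in A; c x y commutes with L_{b'}. Comparing with [c_mulA] gives
     ab = ba. *)
  have E : c x y (z · b) = z · b · a.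
    have -> : z · b = (R z)^-1 (L z b) · z by rewrite /= mulKr'.
    move/inAP: (Hb') => ->; rewrite -Ea.
    by move: (f_equal (fun f : perm => f z) (commute_L_A (fixA_c x y) Hb')) => /= ->.
  have : z · (a · b) = z · (b · a) by rewrite -!mulA_mu // -Ea -c_mulA.
  by move=> H; rewrite -(mulKl z (a · b)) H mulKl.
apply/centerP; split=> // t.
have [b Hb Eb] := eqA_mulr (eqA_T t z).
(* T_t commutes with c x y and moves z only by a factor b of A, with which a commutes. *)
have HT : T t a = a.
  apply: (@stab_fixA _ z) => //; first exact: stab_T.
  rewrite -Ea -[LHS]/((T t * c x y) z) (stab_commute (stab_T t) (stab_c x y)).
  rewrite -[LHS]/(c x y (T t z)) Eb c_mulA // Ea mulA_mu // Hcom // mulA_mu //.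
by rewrite -{2}HT /= mulKl'.
Qed.

Lemma center_mul a x y : center Q a -> x · a · y = x · y · a.
Proof. by move=> [Hc [_ [Hr Hm]]]; rewrite Hm Hc Hr. Qed.

Lemma mul_assoc x y z : exists2 a, center Q a & x · (y · z) = x · y · z · a.
Proof.
have [a Ha Ea] := c_center x z y; exists a => //.
rewrite -center_mul //; have [_ [_ [_ Hm]]] := Ha; have [_ [_ [Hr _]]] := Ha.
by rewrite Hr -Ea /= mulKl' mulKr'.
Qed.

Lemma h_center x w z : exists2 a, center Q a & h x w z = z · a.
Proof.
have [a Ha Ea] := mul_assoc w x z; exists a => //.
by rewrite /= Ea; have [_ [_ [Hr _]]] := Ha; rewrite Hr mulKl.
Qed.

Lemma h_fix x w a : h x w a = a <-> (w · x) · a = w · (x · a).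
Proof. by rewrite /=; split=> [{1}<-|<-]; rewrite ?mulKl' ?mulKl. Qed.

Lemma nucleusP a : nucleus Q a <-> inA a /\ N_rho Q a.
Proof.
split=> [[Hl [Hr _]]|[Ha Hr]]; first by split=> //; apply/inAP.
by split; [apply/inAP | split=> // x y; exact: mulA_mu].
Qed.

(** The factor k is in A. As h x w commutes with T_t and moves z by a central factor, [stab_fixA]
    shows that it fixes k, so k is right nuclear. *)
Lemma T_nucleus t z : exists2 a, nucleus Q a & T t z = z · a.
Proof.
have [k Hk Ek] := eqA_mulr (eqA_T t z); exists k => //.
apply/nucleusP; split=> // w x; apply/h_fix.
have [a Ha Ea] := h_center x w z.
apply: (@stab_fixA _ z) => //; first exact: stab_h.
rewrite -Ek -[LHS]/((h x w * T t) z) (stab_commute (stab_h x w) (stab_T t)).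
rewrite -[LHS]/(T t (h x w z)) Ea center_mul // -Ek /= center_mul //.
by have [_ [_ [Hr _]]] := Ha; rewrite -{1}(mulKl' t (z · t)) Hr mulKl.
Qed.

(** * The nucleus and its factor loop *)

Lemma mulV a : a · (a \ e) = e. Proof. exact: mulKl'. Qed.

Lemma nucleus_mul a b : nucleus Q a -> nucleus Q b -> nucleus Q (a · b).
Proof.
move=> [Hla [Hra Hma]] [Hlb [Hrb Hmb]]; apply/nucleusP; split.
  by apply: inA_M; apply/inAP.
by move=> x y; rewrite -!Hma Hra Hrb.
Qed.

Lemma nucleus_V a : nucleus Q a -> nucleus Q (a \ e).
Proof.
move=> /nucleusP [Ha Hr]; apply/nucleusP; split; first exact: inA_V.
move=> x y; have E : x · (y · (a \ e)) · a = x · y by rewrite !Hr mulVr mul1r.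
by rewrite -E mulA_mu // mulV mul1r.
Qed.

Lemma mulrV_div x a : nucleus Q a -> x / a = x · (a \ e).
Proof.
by move=> /nucleus_V [_ [_ Hm]]; rewrite -[RHS](mulKr _ a) Hm mulVr mul1r.
Qed.

Lemma mlt_perm f : mlt Q f -> exists p : perm, forall q, p q = f q.
Proof.
elim=> [|x f' _ [p Hp]|x f' _ [p Hp]|x f' _ [p Hp]|x f' _ [p Hp]]; first by exists 1.
- by exists (L x * p) => q; rewrite /= Hp.
- by exists ((L x)^-1 * p) => q; rewrite /= Hp.
- by exists (R x * p) => q; rewrite /= Hp.
- by exists ((R x)^-1 * p) => q; rewrite /= Hp.
Qed.

Lemma nucleus_stab f a : stab f -> nucleus Q a -> nucleus Q (f a).
Proof.
move=> Hf /nucleusP [Ha Hr]; apply/nucleusP; split; first exact: inA_stab.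
move=> w x; apply/h_fix; rewrite -[LHS]/((h x w * f) a) (stab_commute (stab_h x w) Hf).
by rewrite -[LHS]/(f (h x w a)); f_equal; apply/h_fix.
Qed.

Lemma nucleus1 : nucleus Q e.
Proof. by apply/nucleusP; split=> [|x y]; [exact: inA1 | rewrite !mul1r]. Qed.

Lemma nucleus_normal : normal Q (nucleus Q).
Proof.
split.
  split; first by exists e; exact: nucleus1.
  split; first exact: nucleus_mul.
  split=> a b Ha Hb; first by rewrite -mulVl; apply: nucleus_mul => //; exact: nucleus_V.
  by rewrite mulrV_div //; apply: nucleus_mul => //; exact: nucleus_V.
move=> f [/mlt_perm [p Hp] Hf]; have Hs : stab p by rewrite /stab Hp.
split=> [a Ha|a Ha]; first by rewrite -Hp; exact: nucleus_stab.
exists (p^-1 a); first by split; [exact: (nucleus_stab (stabV Hs)) | rewrite -Hp; exact: pinvK].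
Qed.

Lemma coset_eq_mul S u v a :
  (forall a, S a -> nucleus Q a) -> (forall a b, S a -> S b -> S (a · b)) ->
  (forall a, S a -> S (a \ e)) -> S a -> u = v · a -> coset_eq Q S u v.
Proof.
move=> HN HM HV Ha -> t; have [_ [_ Hm]] := HN _ Ha; split=> [[b [Hb ->]]|[b [Hb ->]]].
- by exists (a · b); split; [exact: HM | rewrite Hm].
- exists ((a \ e) · b); split; first by apply: HM => //; exact: HV.
  by rewrite Hm mulVl mulKl'.
Qed.

Lemma center_M a b : center Q a -> center Q b -> center Q (a · b).
Proof.
move=> Ha Hb; have [Hca Na] := Ha; have [Hcb Nb] := Hb; split; last exact: nucleus_mul.
move=> x; have [Hla [Hra Hma]] := Na.
by rewrite Hla Hcb -Hla Hca -Hma.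
Qed.

Lemma center_V a : center Q a -> center Q (a \ e).
Proof.
move=> [Hc Na]; split; last exact: nucleus_V.
move=> x; rewrite mulVl -{1}(mulKl a (x · (a \ e))); f_equal.
have [Hl [Hr Hm]] := Na.
by rewrite -Hl Hc Hm mulV mul1r.
Qed.

Lemma quotient_nucleus : quotient_abelian_group Q (nucleus Q).
Proof.
have HE a u v : nucleus Q a -> u = v · a -> coset_eq Q (nucleus Q) u v.
  by apply: coset_eq_mul => //; [exact: nucleus_mul | exact: nucleus_V].
split=> [x y z|x y].
- have [a [_ Na] Ea] := mul_assoc x y z.
  by apply: (HE (a \ e)); [exact: nucleus_V | rewrite Ea; have [_ [_ ->]] := Na; rewrite mulV mul1r].
- have [a Na Ea] := T_nucleus y x; apply: (HE a) => //.
  have [_ [-> _]] := Na; by rewrite -Ea /= mulKl'.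
Qed.

(** * Congruence modulo the center *)

Definition eqZ u v := exists2 a, center Q a & u = v · a.

Lemma center1 : center Q e.
Proof. by split; [move=> x; rewrite mul1l mul1r | exact: nucleus1]. Qed.

Lemma eqZ_refl u : eqZ u u.
Proof. by exists e; [exact: center1 | rewrite mul1r]. Qed.
Lemma eqZ_sym u v : eqZ u v -> eqZ v u.
Proof.
move=> [a Ha ->]; exists (a \ e); first exact: center_V.
by have [_ [_ [_ ->]]] := Ha; rewrite mulV mul1r.
Qed.
Lemma eqZ_trans u v w : eqZ u v -> eqZ v w -> eqZ u w.
Proof.
move=> [a Ha ->] [b Hb ->]; exists (b · a); first exact: center_M.
by have [_ [_ [_ ->]]] := Hb.
Qed.
Lemma eqZ_mul u u' v v' : eqZ u u' -> eqZ v v' -> eqZ (u · v) (u' · v').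
Proof.
move=> [a Ha ->] [b Hb ->]; exists (a · b); first exact: center_M.
by have [Hc [_ [Hr Hm]]] := Hb; rewrite center_mul // -Hr Hm Hc.
Qed.

Lemma eqZ_assoc x y z : eqZ (x · (y · z)) (x · y · z).
Proof. by have [a Ha Ea] := mul_assoc x y z; exists a. Qed.

Lemma eqZ_mulI x y z : eqZ (x · y) (x · z) -> eqZ y z.
Proof.
move=> [a Ha E]; exists a => //; have [_ [_ [Hr _]]] := Ha.
by rewrite -(mulKl x y) E Hr mulKl.
Qed.

(** This describes Z_2(Q), because Q/Z(Q) is a group. *)
Definition centralZ a := forall x, eqZ (a · x) (x · a).

Add Parametric Relation : (car Q) eqZ
  reflexivity proved by eqZ_refl symmetry proved by eqZ_sym transitivity proved by eqZ_trans
  as eqZ_setoid.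
Add Parametric Morphism : (@mul Q) with signature eqZ ==> eqZ ==> eqZ as eqZ_mul_morphism.
Proof. by move=> *; exact: eqZ_mul. Qed.

Lemma centralZ_eqZ a b : eqZ a b -> centralZ a -> centralZ b.
Proof. by move=> H Ha x; rewrite -H; exact: Ha. Qed.

Lemma centralZ_M a b : centralZ a -> centralZ b -> centralZ (a · b).
Proof.
move=> Ha Hb x.
rewrite -(eqZ_assoc a b x) (Hb x) (eqZ_assoc a x b) (Ha x) -(eqZ_assoc x a b).
exact: eqZ_refl.
Qed.

Lemma centralZ_V a : centralZ a -> centralZ (a \ e).
Proof.
move=> Ha x; apply: (@eqZ_mulI a).
rewrite mulVl mulKl' (eqZ_assoc a x (a \ e)) (Ha x) -(eqZ_assoc x a (a \ e)) mulV mul1r.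
exact: eqZ_refl.
Qed.

Lemma centralZ_center a : center Q a -> centralZ a.
Proof. by move=> [Hc _] x; rewrite Hc; exact: eqZ_refl. Qed.

(* Since T_t and T_y commute, conjugation by y t and by t y agree modulo the center. *)
Lemma commutator_centralZ y t : centralZ ((t · y) \ (y · t)).
Proof.
have H u v z : eqZ (u · v · T v (T u z)) (z · (u · v)).
  rewrite -(eqZ_assoc u v (T v (T u z))) mul_T (eqZ_assoc u (T u z) v) mul_T.
  by rewrite -(eqZ_assoc z u v); exact: eqZ_refl.
set k := (t · y) \ (y · t); have Ek : y · t = t · y · k by rewrite /k mulKl'.
move=> p; have [z <-] : exists z, T t (T y z) = p.
  by exists ((T t * T y)^-1 p); exact: (pinvK (T t * T y) p).
apply: (@eqZ_mulI (t · y)).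
rewrite (eqZ_assoc (t · y) k _) -Ek (H y t z) (eqZ_assoc (t · y) _ k).
have -> : T t (T y z) = T y (T t z).
  exact: (f_equal (fun f : perm => f z) (stab_commute (stab_T t) (stab_T y))).
by rewrite (H t y z) -(eqZ_assoc z (t · y) k) -Ek; exact: eqZ_refl.
Qed.

Lemma coset_eqZ u v : coset_eq Q (center Q) u v <-> eqZ u v.
Proof.
split=> [H|[a Ha Ea]].
  have [|a [Ha Ea]] := proj1 (H u); last by exists a.
  by exists e; split; [exact: center1 | rewrite mul1r].
by apply: (@coset_eq_mul _ _ _ a) => //; [move=> b [] | exact: center_M | exact: center_V].
Qed.

Lemma quotient_center : quotient_group Q (center Q).
Proof. by move=> x y z; apply/coset_eqZ/eqZ_sym; exact: eqZ_assoc. Qed.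

Lemma coset_eq_ext S S' u v :
  (forall a, S a <-> S' a) -> coset_eq Q S u v <-> coset_eq Q S' u v.
Proof.
move=> H; have HC w t : coset Q S w t <-> coset Q S' w t.
  by split=> [[a [/H Ha Ea]]|[a [/H Ha Ea]]]; exists a.
by split=> HS t; [rewrite -!HC | rewrite !HC].
Qed.

(** * The upper central series *)

Lemma Zs1 a : Zs Q 1 a <-> center Q a.
Proof.
have H u v : coset_eq Q (Zs Q 0) u v <-> u = v.
  split=> [Huv|-> t //].
  have [|b [-> ->]] := proj1 (Huv u); last by rewrite mul1r.
  by exists e; split=> //; rewrite mul1r.
split=> [[Hc [Hl [Hr Hm]]]|[Hc [Hl [Hr Hm]]]].
- by split=> [x|]; [apply/H | split=> [x y|]; [apply/H | split=> x y; apply/H]].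
- by split=> [x|]; [apply/H | split=> [x y|]; [apply/H | split=> x y; apply/H]].
Qed.

Lemma Zs2 a : Zs Q 2 a <-> centralZ a.
Proof.
have H u v : coset_eq Q (Zs Q 1) u v <-> eqZ u v.
  by rewrite (@coset_eq_ext _ _ u v Zs1); exact: coset_eqZ.
split=> [[Hc _] x|Hc]; first by apply/H.
split=> [x|]; first by apply/H.
by split=> [x y|]; [|split=> x y]; apply/H/eqZ_sym; exact: eqZ_assoc.
Qed.

Lemma coset_eq_centralZ u v a : centralZ a -> u = v · a -> coset_eq Q (Zs Q 2) u v.
Proof.
move=> Ha ->; rewrite (@coset_eq_ext _ _ _ _ Zs2) => t; split=> [[b [Hb ->]]|[b [Hb ->]]].
- have [z Hz Ez] := eqZ_sym (eqZ_assoc v a b).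
  exists (a · b · z); split; last by rewrite Ez; have [_ [_ [-> _]]] := Hz.
  by apply: centralZ_M; [exact: centralZ_M | exact: centralZ_center].
(* Modulo the center this witness is (a \ e) · b. *)
- exists ((v · a) \ (v · b)); split; last by rewrite mulKl'.
  apply: (@centralZ_eqZ ((a \ e) · b)); last by apply: centralZ_M => //; exact: centralZ_V.
  apply: (@eqZ_mulI (v · a)); rewrite mulKl' -(eqZ_assoc v a _) mulVl mulKl'; exact: eqZ_refl.
Qed.

(** Commutators lie in Z_2(Q) and associators in Z(Q), so Q/Z_2(Q) is an abelian group. *)
Lemma Zs3 a : Zs Q 3 a.
Proof.
have H u v : eqZ u v -> coset_eq Q (Zs Q 2) u v.
  by move=> [b Hb Eb]; exact (coset_eq_centralZ v (centralZ_center Hb) Eb).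
split=> [x|].
  by apply: (coset_eq_centralZ _ (commutator_centralZ a x)); rewrite mulKl'.
by split=> [x y|]; [|split=> x y]; apply/H/eqZ_sym; exact: eqZ_assoc.
Qed.

Lemma nilpotent_le3 : exists n, n <= 3 /\ nilpotent_class Q n.
Proof.
have [H0|H0] := classic (forall x, Zs Q 0 x); first by exists 0; split; [do !constructor | split].
have [H1|H1] := classic (forall x, Zs Q 1 x); first by exists 1%nat; split; [do !constructor | split].
have [H2|H2] := classic (forall x, Zs Q 2 x); first by exists 2; split; [do !constructor | split].
by exists 3; split=> //; split=> // x; exact: Zs3.
Qed.

End MultiplicationGroup.

Theorem theorem1 (Q : loop) :
  AIM Q -> LC Q ->
  normal Q (nucleus Q) /\
  quotient_abelian_group Q (nucleus Q) /\
  quotient_group Q (center Q) /\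
  (exists n, n <= 3 /\ nilpotent_class Q n).
Proof.
move=> aim lc; split; first exact: nucleus_normal.
split; first exact: quotient_nucleus.
by split; [exact: quotient_center | exact: nilpotent_le3].
Qed.
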